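(* Let $p(z)=z^n+a_{n-1}z^{n-1}+\cdots+a_1z+a_0$ be a monic polynomial of degree $n$ with coefficients $a_0,\dots,a_{n-1}\in\mathbb{C}$, let $C(p)$ be its Frobenius companion matrix, and let $\lambda$ be a zero of $p(z)$. Then $$|\lambda|\le w(C(p))\le\sqrt{2|a_{n-1}|^2+\frac12\left(\alpha+\beta^2\right)}+\sqrt{2\cos^2\frac{\pi}{n}+\frac12},$$ where $\alpha=\sqrt{\sum_{r=0}^{n-2}|a_ra_{n-1}|^2}$ and $\beta=\sqrt{\sum_{r=0}^{n-2}|a_r|^2}$.
   Context: The Frobenius companion matrix of $p$ is the $n\times n$ matrix $$C(p)=\begin{pmatrix}-a_{n-1}&-a_{n-2}&\cdots&-a_1&-a_0\\1&0&\cdots&0&0\\0&1&\cdots&0&0\\\vdots&\vdots&&\vdots&\vdots\\0&0&\cdots&1&0\end{pmatrix},$$ regarded as an operator on $\mathbb{C}^n$ with the usual inner product. The numerical radius of an operator $T$ on $\mathbb{C}^n$ is $w(T)=\sup\{|\langle Tx,x\rangle| : x\in\mathbb{C}^n,\ \|x\|=1\}$. *)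

(* Defs.v *)
From mathcomp Require Import all_boot all_order all_algebra.
From mathcomp Require Import classical_sets reals trigo.
From mathcomp Require Import complex.

Set Implicit Arguments.
Unset Strict Implicit.
Unset Printing Implicit Defensive.

Import Order.TTheory GRing.Theory Num.Theory.
Local Open Scope ring_scope.
Local Open Scope classical_set_scope.

(* The real-valued modulus; the library's `|z| takes its values in R[i]. *)
Definition cmod (R : realType) (z : R[i]) : R := Normc.normc z.

(* [dotmx] acts on row vectors and is conjugate-linear in its second
   argument: [inner x y = \sum_i x i 0 * (y i 0)^*]. *)
Definition inner (R : realType) (n : nat) (x y : 'cV[R[i]]_n) : R[i] :=
  dotmx x^T y^T.

Definition cnorm (R : realType) (n : nat) (x : 'cV[R[i]]_n) : R :=
  Num.sqrt (cmod (inner x x)).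

(* For 0 < n the set is nonempty and bounded, so that [sup] is its true
   supremum. For n = 0 it is empty and [sup] is 0. *)
Definition numerical_radius (R : realType) (n : nat) (T : 'M[R[i]]_n) : R :=
  sup [set cmod (inner (T *m x) x) | x in [set x : 'cV[R[i]]_n | cnorm x = 1]].

(* The library's [companionmx] has the coefficients in its last row, in
   increasing order; here they are in the first row, in decreasing order. *)
Definition frobenius_companion (R : realType) (n : nat) (p : {poly R[i]}) :
    'M[R[i]]_n :=
  \matrix_(i < n, j < n)
    if i == 0%N :> nat then - p`_(n.-1 - j) else (i == j.+1 :> nat)%:R.

(* Main.v *)
Require Import Defs.
From mathcomp Require Import all_boot all_order all_algebra.
From mathcomp Require Import classical_sets reals trigo.
From mathcomp Require Import complex ring lra.

Import Order.TTheory GRing.Theory Num.Theory.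
Local Open Scope ring_scope.

(** Lower bound: a zero lambda of p is an eigenvalue of the companion matrix,
    with eigenvector (lambda^(n-1), ..., lambda, 1), and an eigenvalue is the
    value of the quadratic form at a normalised eigenvector.

    Upper bound: for a unit vector x put y_i = |x_i|, and let a = |a_(n-1)|.
    The first coordinate of C x is a linear form in x and the others are
    shifted coordinates of x, so the triangle inequality gives
      |<C x, x>| <= y_0 (a y_0 + sum_(j >= 1) |a_(n-1-j)| y_j)
                    + sum_(j >= 1) y_(j-1) y_j.
    The two summands are bounded separately.

    In the first one, y_0^2 <= 1, and the cross term is at most beta / 2 because
    y_0 and the norm of (y_1, ..., y_(n-1)) are the legs of a right triangle
    with hypotenuse 1, whose product is at most 1/2 ([cross_term_le]). Since
    a + beta / 2 <= sqrt (2 a^2 + beta^2 / 2), this summand is at most the first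
    square root of the theorem ([row_bound_le]).

    The second one is the quadratic form of the nilpotent shift. It vanishes for
    n = 1 and is at most 1/2 for n = 2, while the second square root is then
    sqrt (1/2); for n >= 3 it is at most 1 and cos (pi / n) >= cos (pi / 3) = 1/2
    makes the square root at least 1 ([neighbour_sum_le_cos]).

    The same estimate bounds the numerical range, which turns its supremum into
    a genuine upper bound for the lower half of the statement. *)

(** This ties the real-valued modulus to the norm of the number field [R[i]],
    whose theory then transfers along the injective, monotone embedding of [R]. *)
Lemma cmod_norm (R : realType) (z : R[i]) : (cmod z)%:C%C = `|z|.
Proof. by []. Qed.

Lemma cmodD (R : realType) (z w : R[i]) : cmod (z + w) <= cmod z + cmod w.
Proof. by rewrite -lecR rmorphD /= !cmod_norm ler_normD. Qed.

Lemma cmod_sum (R : realType) (I : Type) (r : seq I) (F : I -> R[i]) :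
  cmod (\sum_(i <- r) F i) <= \sum_(i <- r) cmod (F i).
Proof.
elim/big_rec2: _ => [|i y z _ le_zy]; first by rewrite /cmod Normc.normc0.
by apply: (le_trans (cmodD _ _ _)); rewrite lerD2l.
Qed.

Lemma cmod_ge0 (R : realType) (z : R[i]) : 0 <= cmod z.
Proof. by case: z => a b; rewrite /cmod /= sqrtr_ge0. Qed.

Lemma cmodM (R : realType) (z w : R[i]) : cmod (z * w) = cmod z * cmod w.
Proof. exact: Normc.normcM. Qed.

Lemma cmodN (R : realType) (z : R[i]) : cmod (- z) = cmod z.
Proof. by apply: complexI; rewrite !cmod_norm normrN. Qed.

Lemma cmod_real (R : realType) (r : R) : 0 <= r -> cmod r%:C%C = r.
Proof. by move=> r0; rewrite /cmod /= expr0n addr0 sqrtr_sqr ger0_norm. Qed.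

Lemma cmodJ (R : realType) (z : R[i]) : cmod (z^*)%R = cmod z.
Proof. by apply: complexI; rewrite !cmod_norm norm_conjC. Qed.

Lemma inner_sum (R : realType) (n : nat) (x y : 'cV[R[i]]_n) :
  inner x y = \sum_i x i 0 * (y i 0)^*.
Proof.
rewrite /inner dotmxE mxE; apply: eq_bigr => i _.
by rewrite !mxE.
Qed.

Lemma inner_self (R : realType) (n : nat) (x : 'cV[R[i]]_n) :
  inner x x = (\sum_i cmod (x i 0) ^+ 2)%:C%C.
Proof.
rewrite inner_sum rmorph_sum; apply: eq_bigr => i _.
by rewrite rmorphXn /= cmod_norm normCK.
Qed.

Lemma cnormE (R : realType) (n : nat) (x : 'cV[R[i]]_n) :
  cnorm x = Num.sqrt (\sum_i cmod (x i 0) ^+ 2).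
Proof.
by rewrite /cnorm inner_self cmod_real // sumr_ge0 // => i _; exact: sqr_ge0.
Qed.

Lemma cnorm_eq1 (R : realType) (n : nat) (x : 'cV[R[i]]_n) :
  cnorm x = 1 -> \sum_i cmod (x i 0) ^+ 2 = 1.
Proof.
rewrite cnormE => nx.
rewrite -[LHS]sqr_sqrtr ?nx ?expr1n // sumr_ge0 // => i _; exact: sqr_ge0.
Qed.

(** The first row of the product is the equation p(lambda) = 0 solved for
    lambda^n; every other row shifts the powers of lambda by one. *)
Lemma companion_eigenvector (R : realType) (m : nat) (p : {poly R[i]})
    (lambda : R[i]) :
  p \is monic -> size p = m.+2 -> root p lambda ->
  let v := \col_(i < m.+1) lambda ^+ (m - i) in
  frobenius_companion m.+1 p *m v = lambda *: v.
Proof.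
move=> p_monic p_size /rootP p_root v; apply/matrixP => i k; rewrite !mxE.
case: i => [[|i] lt_i] /=.
  (* The matrix lists coefficients by decreasing degree, [horner_coef] by
     increasing degree. *)
  under eq_bigr => j _ do rewrite !mxE /=.
  rewrite (reindex_inj rev_ord_inj) /=.
  move: p_root; rewrite horner_coef p_size big_ord_recr /=.
  have -> : p`_m.+1 = 1 by move/monicP: p_monic; rewrite lead_coefE p_size.
  rewrite mul1r subn0 -exprS => /eqP; rewrite addrC addr_eq0 => /eqP ->.
  rewrite -sumrN; apply: eq_bigr => j _.
  by rewrite subSS !(subKn (leq_ord j)) mulNr.
have lt_i' : (i < m.+1)%N by apply: ltnW.
rewrite (bigD1 (Ordinal lt_i')) //= !mxE /= eqxx mul1r big1 ?addr0.
  by rewrite -exprS subnSK.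
move=> j ne_j; rewrite !mxE /= eqSS.
suff -> : (i == j)%N = false by rewrite mul0r.
by apply: contraNF ne_j => /eqP e; apply/eqP/val_inj.
Qed.

(** At a normalised eigenvector the quadratic form of T is lambda <x, x>, which
    is lambda. *)
Lemma eigenvalue_in_range (R : realType) (n : nat) (T : 'M[R[i]]_n)
    (lambda : R[i]) (v : 'cV[R[i]]_n) :
  v != 0 -> T *m v = lambda *: v ->
  exists2 x : 'cV[R[i]]_n, cnorm x = 1 & cmod (inner (T *m x) x) = cmod lambda.
Proof.
move=> v0 Tv; set s := \sum_i cmod (v i 0) ^+ 2.
have s_ge0 : 0 <= s by apply: sumr_ge0 => i _; exact: sqr_ge0.
have s_gt0 : 0 < s.
  rewrite lt_def s_ge0 andbT; apply: contra v0 => s0.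
  apply/eqP/matrixP => i k; rewrite !mxE ord1.
  apply: Normc.eq0_normc; apply/eqP; rewrite -sqrf_eq0.
  by move: s0; rewrite psumr_eq0 => [/allP/(_ i (mem_index_enum i))//|j _]; exact: sqr_ge0.
pose c := (Num.sqrt s)^-1.
have xE : \sum_i cmod ((c%:C%C *: v) i 0) ^+ 2 = 1.
  under eq_bigr => i _ do rewrite mxE cmodM cmod_real ?invr_ge0 ?sqrtr_ge0 // exprMn.
  by rewrite -mulr_sumr /c exprVn sqr_sqrtr // mulVf // gt_eqF.
exists (c%:C%C *: v); first by rewrite cnormE xE sqrtr1.
rewrite -scalemxAr Tv scalerA mulrC -scalerA inner_sum.
under eq_bigr => i _ do rewrite mxE -mulrA.
by rewrite -mulr_sumr -inner_sum inner_self xE cmodM cmod_real // mulr1.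
Qed.

(** With beta the norm of b, the sum of the squares (beta y_j - t b_j)^2 equals
    beta^2 (|y|^2 + t^2) - 2 beta t <b, y> = beta (beta - 2 t <b, y>). It is
    nonnegative, and dividing by beta gives the claim without a separate
    Cauchy-Schwarz step. *)
Lemma cross_term_le (R : realType) (m : nat) (b y : 'I_m -> R) (t : R) :
  t ^+ 2 + \sum_j y j ^+ 2 = 1 ->
  t * \sum_j b j * y j <= Num.sqrt (\sum_j b j ^+ 2) / 2.
Proof.
set S := \sum_j b j * y j; set Y := \sum_j y j ^+ 2; set B := \sum_j b j ^+ 2.
move=> tY; set beta := Num.sqrt B.
have B_ge0 : 0 <= B by apply: sumr_ge0 => j _; exact: sqr_ge0.
have betaE : beta ^+ 2 = B by rewrite sqr_sqrtr.
have sq_ge0 : 0 <= \sum_j (beta * y j - t * b j) ^+ 2.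
  by apply: sumr_ge0 => j _; exact: sqr_ge0.
have sqE : \sum_j (beta * y j - t * b j) ^+ 2 = beta ^+ 2 * Y + t ^+ 2 * B - 2 * beta * t * S.
  rewrite !mulr_sumr -big_split -sumrB; apply: eq_bigr => j _ /=; ring.
rewrite sqE -betaE in sq_ge0.
have [beta_gt0|] := ltP 0 beta; last first.
  (* For beta = 0 the division is impossible, but then b itself is zero. *)
  rewrite le_eqVlt ltNge sqrtr_ge0 orbF => /eqP beta0; rewrite beta0 mul0r.
  move/eqP: betaE; rewrite beta0 expr0n eq_sym /= psumr_eq0 => [/allP b0|j _]; last exact: sqr_ge0.
  rewrite /S big1 ?mulr0 // => j _.
  by have := b0 j (mem_index_enum j); rewrite /= sqrf_eq0 => /eqP ->; rewrite mul0r.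
rewrite ler_pdivlMr // -(ler_pM2l beta_gt0).
have YE : Y = 1 - t ^+ 2 by rewrite -tY; ring.
rewrite YE in sq_ge0; lra.
Qed.

(** Each product is at most the mean of the two squares, and each family of
    neighbours, left or right, misses one coordinate of a unit vector. *)
Lemma neighbour_sum_le (R : realType) (m : nat) (y : 'I_m.+1 -> R) :
  \sum_j y j ^+ 2 = 1 ->
  \sum_(j < m) y (widen_ord (leqnSn m) j) * y (lift ord0 j) <= 1.
Proof.
move=> y1.
have left_le : \sum_(j < m) y (widen_ord (leqnSn m) j) ^+ 2 <= 1.
  by rewrite -y1 big_ord_recr /= lerDl sqr_ge0.
have right_le : \sum_(j < m) y (lift ord0 j) ^+ 2 <= 1.
  by rewrite -y1 big_ord_recl /= lerDr sqr_ge0.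
apply: (@le_trans _ _ (2^-1 * (\sum_(j < m) y (widen_ord (leqnSn m) j) ^+ 2
   + \sum_(j < m) y (lift ord0 j) ^+ 2))); last lra.
rewrite -big_split /= mulr_sumr; apply: ler_sum => j _; rewrite -subr_ge0.
set u := y _; set w := y _.
have := sqr_ge0 (u - w); lra.
Qed.

(** pi/3 and 2 pi/3 are supplementary, so 2 cos (pi/3) sin (pi/3) = sin (pi/3). *)
Lemma cos_pi3 (R : realType) : cos (pi / 3) = 2^-1 :> R.
Proof.
have pi_gt0 := pi_gt0 R.
have s_gt0 : 0 < sin (pi / 3) :> R by apply: sin_gt0_pi; apply/andP; split; lra.
have : sin (pi / 3 *+ 2) = sin (pi / 3) :> R.
  rewrite -[RHS]opprK -sinN -[- sin _]sinDpi; congr sin; lra.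
rewrite sin_mulr2n => e.
apply: (mulIf (lt0r_neq0 s_gt0)); lra.
Qed.

Lemma cos_pi_div_ge (R : realType) (n : nat) :
  (3 <= n)%N -> 2^-1 <= cos (pi / n%:R) :> R.
Proof.
move=> n3; have pi_gt0 := pi_gt0 R.
have n3R : 3 <= n%:R :> R by rewrite (ler_nat R 3 n).
have n0 : 0 < n%:R :> R by apply: lt_le_trans n3R.
have le_pi3 : pi / n%:R <= pi / 3 :> R.
  by rewrite ler_pM2l // lef_pV2 ?posrE.
have ge0 : 0 <= pi / n%:R :> R by rewrite divr_ge0 ?ltW.
rewrite -cos_pi3 leNgt ltr_cos ?in_itv /= -?leNgt //; apply/andP; split; lra.
Qed.

(** The left side is bounded by 0, 1/2 or 1 according as the dimension is 1, 2
    or at least 3; these crude values suffice, although the sharp one is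
    cos (pi / (n + 1)). *)
Lemma neighbour_sum_le_cos (R : realType) (m : nat) (y : 'I_m.+1 -> R) :
  \sum_j y j ^+ 2 = 1 ->
  \sum_(j < m) y (widen_ord (leqnSn m) j) * y (lift ord0 j)
    <= Num.sqrt (2 * cos (pi / m.+1%:R) ^+ 2 + 2^-1).
Proof.
case: m y => [|[|m]] y y1; first by rewrite big_ord0 sqrtr_ge0.
  rewrite cos_pihalf expr0n mulr0 add0r big_ord_recl big_ord0 addr0.
  apply: (@le_trans _ _ 2^-1).
    have := sqr_ge0 (y (widen_ord (leqnSn 1) ord0) - y (lift ord0 ord0)).
    move: y1; rewrite !big_ord_recl big_ord0.
    have -> : widen_ord (leqnSn 1) ord0 = ord0 by apply: val_inj.
    by lra.
  by rewrite -ler_sqr ?nnegrE ?sqrtr_ge0 ?sqr_sqrtr ?invr_ge0 //; lra.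
apply: le_trans (neighbour_sum_le _ _ _ y1) _.
have := @cos_pi_div_ge R m.+3 isT; set c := cos _ => c_ge.
rewrite -ler_sqr ?nnegrE ?sqrtr_ge0 // sqr_sqrtr; last nra.
nra.
Qed.

(** The coordinate x_0 contributes the form of the first row, the remaining ones
    that of the shift; y stands for the vector of the moduli |x_i|. *)
Lemma companion_form_le (R : realType) (m : nat) (p : {poly R[i]})
    (x : 'cV[R[i]]_m.+1) :
  cnorm x = 1 ->
  cmod (inner (frobenius_companion m.+1 p *m x) x)
    <= cmod p`_m + Num.sqrt (\sum_(r < m) cmod p`_r ^+ 2) / 2
       + Num.sqrt (2 * cos (pi / m.+1%:R) ^+ 2 + 2^-1).
Proof.
move=> /cnorm_eq1 x1; pose y i := cmod (x i 0).
have y_ge0 i : 0 <= y i by exact: cmod_ge0.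
rewrite inner_sum; apply: le_trans (cmod_sum _ _ _ _) _.
under eq_bigr => i _ do rewrite cmodM cmodJ.
rewrite big_ord_recl; apply: lerD; last first.
  apply: le_trans (neighbour_sum_le_cos _ _ _ x1).
  rewrite le_eqVlt; apply/orP; left; apply/eqP.
  apply: eq_bigr => j _; congr (cmod _ * _).
  rewrite mxE (bigD1 (widen_ord (leqnSn m) j)) //= !mxE /= eqxx mul1r.
  rewrite big1 ?addr0 // => k ne_k.
  rewrite mxE /= /bump leq0n add1n eqSS.
  suff -> : (j == k :> nat) = false by rewrite mul0r.
  by apply: contraNF ne_k => /eqP e; apply/eqP/val_inj.
rewrite mxE big_ord_recl !mxE /= subn0.
pose b (j : 'I_m) := cmod p`_(m - j.+1).
have row_le : cmod (- p`_m * x ord0 0 + \sum_(j < m)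
      frobenius_companion m.+1 p ord0 (lift ord0 j) * x (lift ord0 j) 0)
    <= cmod p`_m * y ord0 + \sum_j b j * y (lift ord0 j).
  apply: le_trans (cmodD _ _ _) _; rewrite cmodM cmodN lerD2l.
  apply: le_trans (cmod_sum _ _ _ _) _; apply: ler_sum => j _.
  by rewrite mxE /= cmodM cmodN.
apply: le_trans (ler_wpM2r (y_ge0 ord0) row_le) _.
rewrite mulrDl; apply: lerD.
  rewrite -mulrA ler_piMr ?cmod_ge0 // -expr2 -x1 big_ord_recl lerDl.
  by apply: sumr_ge0 => j _; exact: sqr_ge0.
(* The row carries the coefficients by decreasing degree, and beta sums them by
   increasing degree. *)
rewrite mulrC [X in Num.sqrt X](reindex_inj rev_ord_inj) /=.
by apply: cross_term_le; rewrite -x1 big_ord_recl.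
Qed.

(** After squaring, this is (a - beta / 2)^2 >= 0 together with alpha >= 0. *)
Lemma row_bound_le (R : realType) (a alpha beta : R) :
  0 <= a -> 0 <= alpha -> 0 <= beta ->
  a + beta / 2 <= Num.sqrt (2 * a ^+ 2 + 2^-1 * (alpha + beta ^+ 2)).
Proof.
move=> a0 al0 b0; rewrite -ler_sqr ?nnegrE ?sqrtr_ge0 //; last lra.
rewrite sqr_sqrtr; last nra.
have := sqr_ge0 (a - beta / 2); lra.
Qed.

Theorem theorem3p10 (R : realType) (n : nat) (p : {poly R[i]}) (lambda : R[i])
    (p_monic : p \is monic) (p_size : size p = n.+1)
    (p_root : root p lambda) :
  let alpha := Num.sqrt (\sum_(r < n.-1) cmod (p`_r * p`_n.-1) ^+ 2) : R in
  let beta := Num.sqrt (\sum_(r < n.-1) cmod p`_r ^+ 2) : R in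
  cmod lambda <= numerical_radius (frobenius_companion n p) /\
  numerical_radius (frobenius_companion n p) <=
    Num.sqrt (2 * cmod p`_n.-1 ^+ 2 + 2^-1 * (alpha + beta ^+ 2))
    + Num.sqrt (2 * cos (pi / n%:R) ^+ 2 + 2^-1).
Proof.
case: n p_size => [|m] p_size alpha beta.
  by move: (root_size_gt1 (monic_neq0 p_monic) p_root); rewrite p_size.
set v := \col_(i < m.+1) lambda ^+ (m - i).
have v_neq0 : v != 0.
  apply/eqP => /matrixP /(_ ord_max 0) /eqP.
  by rewrite !mxE subnn expr0 oner_eq0.
have [x x1 x_lambda] := eigenvalue_in_range _ _ _ _ _ v_neq0
  (companion_eigenvector _ _ _ _ p_monic p_size p_root).
have ubW := fun y (y1 : cnorm y = 1) => le_trans (companion_form_le _ _ p y y1)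
  (lerD (row_bound_le _ _ alpha beta (cmod_ge0 _ p`_m) (sqrtr_ge0 _) (sqrtr_ge0 _))
        (lexx _)).
split.
  rewrite -x_lambda; apply: ub_le_sup; last by exists x.
  by eexists => _ [y y1 <-]; exact: ubW.
apply: ge_sup; first by eexists; exists x.
by move=> _ [y y1 <-]; exact: ubW.
Qed.
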